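(* Let $\mathcal{A}$ be a Hopf algebra with invertible antipode over a field, let $\mathcal{N}\subset\mathcal{A}$ be a left coideal subalgebra, and let $P$ be a right group-like projection which is a counital two sided integral for $\mathcal{N}$. Then $\mathcal{N}\subset\mathcal{N}_P$. In other words, $\mathcal{N}_P$ is a maximal left coideal subalgebra for which $P$ is a counital two sided integral. Analogously: if $P$ is a right group-like projection which is a counital right (respectively left) integral for $\mathcal{N}$, then $\mathcal{N}\subset\mathcal{N}_P^l$ (respectively $\mathcal{N}\subset\mathcal{N}_P^r$), i.e. $\mathcal{N}^l_P$ (respectively $\mathcal{N}^r_P$) is a maximal left coideal subalgebra for which $P$ is a counital right (respectively left) integral.
   Context: $(\mathcal{A},\Delta,S,\varepsilon)$ is a Hopf algebra over an arbitrary field with invertible antipode $S$ and unit $1$. A projection is an idempotent. A right group-like projection is a non-zero projection $P\in\mathcal{A}$ with $\Delta(P)(1\otimes P)=P\otimes P=(1\otimes P)\Delta(P)$. A left coideal subalgebra is a unital subalgebra $\mathcal{N}\subset\mathcal{A}$ with $\Delta(\mathcal{N})\subset\mathcal{A}\otimes\mathcal{N}$. For a right group-like projection $P$ define the left coideal subalgebras $\mathcal{N}^l_P=\{x\in\mathcal{A}:(1\otimes P)\Delta(x)=x\otimes P\}$, $\mathcal{N}^r_P=\{x\in\mathcal{A}:\Delta(x)(1\otimes P)=x\otimes P\}$, $\mathcal{N}_P=\mathcal{N}^l_P\cap\mathcal{N}^r_P$. A left integral for a left coideal subalgebra $\mathcal{N}$ is an element $\Lambda\in\mathcal{N}$ with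 $x\Lambda=\varepsilon(x)\Lambda$ for all $x\in\mathcal{N}$; a right integral is an element $\Lambda\in\mathcal{N}$ with $\Lambda x=\varepsilon(x)\Lambda$ for all $x\in\mathcal{N}$; a two sided integral is one that is both. An integral $\Lambda$ is counital if $\varepsilon(\Lambda)=1$. *)

(* Defs.v *)
From HB Require Import structures.
From mathcomp Require Import all_boot all_algebra generic_quotient.
From mathcomp Require Import boolp classical_sets.

Set Implicit Arguments.
Unset Strict Implicit.
Unset Printing Implicit Defensive.

Import GRing.Theory.
Local Open Scope quotient_scope.
Local Open Scope ring_scope.

(* The library has no tensor product of infinite-dimensional spaces.          *)
(* [U (x) V] is built here as the free commutative monoid on [U * V] (a       *)
(* sequence of pairs stands for the sum of its entries) modulo the congruence *)
(* generated by bilinearity; scalars and opposites act on the first factor.   *)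
Section TensorRelation.
Variables (K : fieldType) (U V : lmodType K).

Inductive tensor_rel : seq (U * V) -> seq (U * V) -> Prop :=
| TensorRefl s : tensor_rel s s
| TensorSym s t : tensor_rel s t -> tensor_rel t s
| TensorTrans s t r : tensor_rel s t -> tensor_rel t r -> tensor_rel s r
| TensorCat s s' t t' :
    tensor_rel s s' -> tensor_rel t t' -> tensor_rel (s ++ t) (s' ++ t')
| TensorC s t : tensor_rel (s ++ t) (t ++ s)
| Tensor0l v : tensor_rel [:: (0, v)] [::]
| TensorDl u u' v : tensor_rel [:: (u + u', v)] [:: (u, v); (u', v)]
| TensorDr u v v' : tensor_rel [:: (u, v + v')] [:: (u, v); (u, v')]
| TensorZ c u v : tensor_rel [:: (c *: u, v)] [:: (u, c *: v)].

Definition tensor_eqb : rel (seq (U * V)) := fun s t => `[< tensor_rel s t >].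

Lemma tensor_eqb_refl : reflexive tensor_eqb.
Proof. by move=> s; apply/asboolP/TensorRefl. Qed.

Lemma tensor_eqb_sym : symmetric tensor_eqb.
Proof. by move=> s t; apply/asboolP/asboolP => /TensorSym. Qed.

Lemma tensor_eqb_trans : transitive tensor_eqb.
Proof.
by move=> t s r /asboolP st /asboolP tr; apply/asboolP/(TensorTrans st tr).
Qed.

Canonical tensor_equiv :=
  EquivRel tensor_eqb tensor_eqb_refl tensor_eqb_sym tensor_eqb_trans.

Definition tensor := {eq_quot tensor_equiv}.

HB.instance Definition _ := Choice.on tensor.
HB.instance Definition _ := EqQuotient.on tensor.

Definition tens (u : U) (v : V) : tensor := \pi_tensor [:: (u, v)].

Lemma tensor_relP s t : \pi_tensor s = \pi_tensor t <-> tensor_rel s t.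
Proof.
split=> [/eqP|st]; first by rewrite eqmodE => /asboolP.
by apply/eqP; rewrite eqmodE; apply/asboolP.
Qed.

Lemma tensor_repr s : tensor_rel (repr (\pi_tensor s)) s.
Proof. by apply/tensor_relP; rewrite reprK. Qed.

Lemma tensorW (x : tensor) : exists s, x = \pi_tensor s.
Proof. by exists (repr x); rewrite reprK. Qed.

Lemma tensor_rel_shift p q s t :
  tensor_rel (p :: (s ++ q :: t)) ([:: p; q] ++ (s ++ t)).
Proof.
apply: (TensorCat (TensorRefl [:: p])).
rewrite -(cat1s q t) -(cat1s q (s ++ t)) !catA.
exact: TensorCat (TensorC s [:: q]) (TensorRefl t).
Qed.

Lemma tensor_relZ c s t : tensor_rel s t ->
  tensor_rel [seq (c *: p.1, p.2) | p <- s] [seq (c *: p.1, p.2) | p <- t].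
Proof.
elim=> {s t} /=.
- by move=> s; apply: TensorRefl.
- by move=> s t _; apply: TensorSym.
- by move=> s t r _ st _; apply: TensorTrans.
- by move=> s s' t t' _ ss' _ tt'; rewrite !map_cat; apply: TensorCat.
- by move=> s t; rewrite !map_cat; apply: TensorC.
- by move=> v; rewrite scaler0; apply: Tensor0l.
- by move=> u u' v; rewrite scalerDr; apply: TensorDl.
- by move=> u v v'; apply: TensorDr.
- by move=> d u v; rewrite scalerA mulrC -scalerA; apply: TensorZ.
Qed.

Definition tensor_add (x y : tensor) : tensor := \pi_tensor (repr x ++ repr y).
Definition tensor_scale (c : K) (x : tensor) : tensor :=
  \pi_tensor [seq (c *: p.1, p.2) | p <- repr x].
Definition tensor_opp (x : tensor) : tensor := tensor_scale (-1) x.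
Definition tensor_zero : tensor := \pi_tensor [::].

Lemma tensor_addE s t :
  tensor_add (\pi_tensor s) (\pi_tensor t) = \pi_tensor (s ++ t).
Proof. by apply/tensor_relP/TensorCat; apply: tensor_repr. Qed.

Lemma tensor_scaleE c s :
  tensor_scale c (\pi_tensor s) = \pi_tensor [seq (c *: p.1, p.2) | p <- s].
Proof. exact/tensor_relP/tensor_relZ/tensor_repr. Qed.

Lemma tensor_addA : associative tensor_add.
Proof.
move=> x y z; have [s ->] := tensorW x; have [t ->] := tensorW y.
by have [r ->] := tensorW z; rewrite !tensor_addE catA.
Qed.

Lemma tensor_addC : commutative tensor_add.
Proof.
move=> x y; have [s ->] := tensorW x; have [t ->] := tensorW y.
rewrite !tensor_addE.
exact/tensor_relP/TensorC.
Qed.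

Lemma tensor_add0 : left_id tensor_zero tensor_add.
Proof. by move=> x; have [s ->] := tensorW x; rewrite tensor_addE. Qed.

Lemma tensor_addN : left_inverse tensor_zero tensor_opp tensor_add.
Proof.
move=> x; have [s ->] := tensorW x; rewrite /tensor_opp.
rewrite tensor_scaleE tensor_addE.
apply/tensor_relP; elim: s => [|[u v] s IHs] /=; first exact: TensorRefl.
set s' := map _ s in IHs *.
have uv0 : tensor_rel [:: (-1 *: u, v); (u, v)] [::].
  apply: TensorTrans (TensorSym (TensorDl _ _ _)) _.
  by rewrite scaleN1r addNr; apply: Tensor0l.
exact: TensorTrans (tensor_rel_shift _ _ _ _) (TensorCat uv0 IHs).
Qed.

HB.instance Definition _ :=
  GRing.isZmodule.Build tensor tensor_addA tensor_addC tensor_add0 tensor_addN.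

Lemma tensor_scaleA a b x :
  tensor_scale a (tensor_scale b x) = tensor_scale (a * b) x.
Proof.
have [s ->] := tensorW x; rewrite !tensor_scaleE -map_comp; congr \pi_tensor.
by apply: eq_map => -[u v] /=; rewrite scalerA.
Qed.

Lemma tensor_scale1 : left_id 1 tensor_scale.
Proof.
move=> x; have [s ->] := tensorW x; rewrite tensor_scaleE -[in RHS](map_id s).
congr \pi_tensor.
by apply: eq_map => -[u v] /=; rewrite scale1r.
Qed.

Lemma tensor_scaleDr : right_distributive tensor_scale +%R.
Proof.
move=> c x y; have [s ->] := tensorW x; have [t ->] := tensorW y.
by rewrite [_ + _]tensor_addE !tensor_scaleE map_cat [RHS]tensor_addE.
Qed.

Lemma tensor_scaleDl x : {morph tensor_scale^~ x : a b / a + b}.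
Proof.
move=> a b; have [s ->] := tensorW x; rewrite !tensor_scaleE [RHS]tensor_addE.
apply/tensor_relP; elim: s => [|[u v] s IHs] /=; first exact: TensorRefl.
rewrite scalerDl -cat1s.
apply: TensorTrans (TensorCat (TensorDl _ _ _) IHs) _.
exact/TensorSym/tensor_rel_shift.
Qed.

HB.instance Definition _ := GRing.Zmodule_isLmodule.Build K tensor
  tensor_scaleA tensor_scale1 tensor_scaleDr tensor_scaleDl.

Lemma pi_tensorE s : \pi_tensor s = \sum_(p <- s) tens p.1 p.2 :> tensor.
Proof.
elim: s => [|[u v] s IHs]; first by rewrite big_nil.
by rewrite big_cons -IHs [RHS]tensor_addE.
Qed.

Lemma tens_bilinear : bilinear_for *:%R *:%R tens.
Proof.
have Zr c u v : tens u (c *: v) = c *: tens u v.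
  by rewrite [RHS]tensor_scaleE; apply/tensor_relP/TensorSym/TensorZ.
split=> [v c u u'|u c v v'] /=; last first.
  by rewrite -Zr [RHS]tensor_addE; apply/tensor_relP/TensorDr.
rewrite [c *: tens u v]tensor_scaleE.
by rewrite [RHS]tensor_addE; apply/tensor_relP/TensorDl.
Qed.

End TensorRelation.

Arguments tens {K U V}.

Notation "u ⊗ v" := (tens u v)
  (at level 40, left associativity, format "u  ⊗  v") : ring_scope.

HB.instance Definition _ (K : fieldType) (U V : lmodType K) :=
  bilinear_isBilinear.Build K U V (tensor U V) *:%R *:%R (@tens K U V)
    (@tens_bilinear K U V).

Section TensorLift.
Variables (K : fieldType) (U V W : lmodType K).

(* The linear map induced by a bilinear [f]; it does not depend on the chosen *)
(* representative only because [f] is bilinear.                               *)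
Definition tensor_lift (f : {bilinear U -> V -> W}) (x : tensor U V) : W :=
  \sum_(p <- repr x) f p.1 p.2.

Variable f : {bilinear U -> V -> W}.

Lemma tensor_lift_rel s t : tensor_rel s t ->
  \sum_(p <- s) f p.1 p.2 = \sum_(p <- t) f p.1 p.2.
Proof.
elim=> {s t} //=.
- by move=> s t r _ -> _ ->.
- by move=> s s' t t' _ ss' _ tt'; rewrite !big_cat /= ss' tt'.
- by move=> s t; rewrite !big_cat /= addrC.
- by move=> v; rewrite big_seq1 big_nil /= linear0l.
- by move=> u u' v; rewrite !big_cons !big_nil /= linearDl /= !addr0.
- by move=> u v v'; rewrite !big_cons !big_nil /= linearD /= !addr0.
- by move=> c u v; rewrite !big_seq1 /= linearZl linearZ.
Qed.

Lemma tensor_lift_pi s :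
  tensor_lift f (\pi_(tensor U V) s) = \sum_(p <- s) f p.1 p.2.
Proof. exact/tensor_lift_rel/tensor_repr. Qed.

Lemma tensor_lift_tens u v : tensor_lift f (u ⊗ v) = f u v.
Proof. by rewrite tensor_lift_pi big_seq1. Qed.

Lemma tensor_lift_linear : linear (tensor_lift f).
Proof.
move=> c x y; have [s ->] := tensorW x; have [t ->] := tensorW y.
have -> : c *: \pi_(tensor U V) s + \pi_(tensor U V) t =
  \pi_(tensor U V) ([seq (c *: p.1, p.2) | p <- s] ++ t).
  by rewrite -tensor_addE -tensor_scaleE.
rewrite !tensor_lift_pi big_cat big_map /= scaler_sumr; congr (_ + _).
by apply: eq_bigr => p _; rewrite linearZl.
Qed.

HB.instance Definition _ := GRing.isLinear.Build K (tensor U V) W *:%R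
  (tensor_lift f) tensor_lift_linear.

End TensorLift.

Lemma tensor_linear_ext (K : fieldType) (U V W : lmodType K)
    (g h : {linear tensor U V -> W}) :
  (forall u v, g (u ⊗ v) = h (u ⊗ v)) -> g =1 h.
Proof.
move=> gh x; have [s ->] := tensorW x; rewrite pi_tensorE !linear_sum.
by apply: eq_bigr => p _; apply: gh.
Qed.

Section TensorMap.
Variables (K : fieldType) (U U' V V' : lmodType K).
Variables (f : {linear U -> U'}) (g : {linear V -> V'}).

Definition tensor_map_fun (u : U) (v : V) : tensor U' V' := f u ⊗ g v.

Lemma tensor_map_fun_bilinear : bilinear_for *:%R *:%R tensor_map_fun.
Proof.
split=> [v c u u'|u c v v']; rewrite /= /tensor_map_fun linearP.
  exact: linearPl.
exact: linearPr.
Qed.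

HB.instance Definition _ := bilinear_isBilinear.Build K U V (tensor U' V')
  *:%R *:%R tensor_map_fun tensor_map_fun_bilinear.

Definition tensor_map : tensor U V -> tensor U' V' :=
  tensor_lift tensor_map_fun.

HB.instance Definition _ := GRing.Linear.on tensor_map.

Lemma tensor_map_tens u v : tensor_map (u ⊗ v) = f u ⊗ g v.
Proof. exact: tensor_lift_tens. Qed.

End TensorMap.

Section TensorAssoc.
Variables (K : fieldType) (U V W : lmodType K).

Definition tensor_assoc_fun1 (w : W) (u : U) (v : V) :
  tensor U (tensor V W) := u ⊗ (v ⊗ w).

Lemma tensor_assoc_fun1_bilinear w :
  bilinear_for *:%R *:%R (tensor_assoc_fun1 w).
Proof.
split=> [v c u u'|u c v v']; rewrite /= /tensor_assoc_fun1.
  by rewrite linearPl.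
by rewrite linearPl linearPr.
Qed.

HB.instance Definition _ w :=
  bilinear_isBilinear.Build K U V (tensor U (tensor V W)) *:%R *:%R
    (tensor_assoc_fun1 w) (tensor_assoc_fun1_bilinear w).

Definition tensor_assoc_fun (x : tensor U V) (w : W) :
  tensor U (tensor V W) := tensor_lift (tensor_assoc_fun1 w) x.

Lemma tensor_assoc_fun_bilinear : bilinear_for *:%R *:%R tensor_assoc_fun.
Proof.
split=> [w c x y|x c w w'] /=; first exact: linearP.
have [s ->] := tensorW x; rewrite /tensor_assoc_fun !tensor_lift_pi.
rewrite scaler_sumr -big_split; apply: eq_bigr => -[u v] _ /=.
by rewrite /tensor_assoc_fun1 !linearPr.
Qed.

HB.instance Definition _ :=
  bilinear_isBilinear.Build K (tensor U V) W (tensor U (tensor V W))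
    *:%R *:%R tensor_assoc_fun tensor_assoc_fun_bilinear.

Definition tensor_assoc :
  tensor (tensor U V) W -> tensor U (tensor V W) :=
  tensor_lift tensor_assoc_fun.

HB.instance Definition _ := GRing.Linear.on tensor_assoc.

Lemma tensor_assoc_tens u v w : tensor_assoc (u ⊗ v ⊗ w) = u ⊗ (v ⊗ w).
Proof. by rewrite [LHS]tensor_lift_tens [LHS]tensor_lift_tens. Qed.

End TensorAssoc.

Section TensorAlgebra.
Variables (K : fieldType) (A B : algType K).

Definition tensor_mul_fun1 (a : A) (b : B) (a' : A) (b' : B) : tensor A B :=
  (a * a') ⊗ (b * b').

Lemma tensor_mul_fun1_bilinear a b :
  bilinear_for *:%R *:%R (tensor_mul_fun1 a b).
Proof.
split=> [b' c a' a''|a' c b' b'']; rewrite /= /tensor_mul_fun1 mulrDr -scalerAr.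
  exact: linearPl.
exact: linearPr.
Qed.

HB.instance Definition _ a b :=
  bilinear_isBilinear.Build K A B (tensor A B) *:%R *:%R
    (tensor_mul_fun1 a b) (tensor_mul_fun1_bilinear a b).

Definition tensor_mul_fun (y : tensor A B) (a : A) (b : B) : tensor A B :=
  tensor_lift (tensor_mul_fun1 a b) y.

Lemma tensor_mul_fun_bilinear y : bilinear_for *:%R *:%R (tensor_mul_fun y).
Proof.
have [s ->] := tensorW y.
split=> [b c a a'|a c b b']; rewrite /= /tensor_mul_fun !tensor_lift_pi;
  rewrite scaler_sumr -big_split; apply: eq_bigr => -[u v] _ /=;
  rewrite /tensor_mul_fun1 mulrDl -scalerAl.
  exact: linearPl.
exact: linearPr.
Qed.

HB.instance Definition _ y :=
  bilinear_isBilinear.Build K A B (tensor A B) *:%R *:%R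
    (tensor_mul_fun y) (tensor_mul_fun_bilinear y).

Definition tensor_mul (x y : tensor A B) : tensor A B :=
  tensor_lift (tensor_mul_fun y) x.

Definition tensor_one : tensor A B := 1 ⊗ 1.

Lemma tensor_mul_tens a b a' b' :
  tensor_mul (a ⊗ b) (a' ⊗ b') = (a * a') ⊗ (b * b').
Proof. by rewrite [LHS]tensor_lift_tens [LHS]tensor_lift_tens. Qed.

Lemma tensor_mulDl : left_distributive tensor_mul +%R.
Proof. by move=> x y z; apply: linearD. Qed.

Lemma tensor_mulDr : right_distributive tensor_mul +%R.
Proof.
move=> x y z; have [s ->] := tensorW x; rewrite /tensor_mul !tensor_lift_pi.
by rewrite -big_split; apply: eq_bigr => p _; apply: linearD.
Qed.

Lemma tensor_mul0l : left_zero 0 tensor_mul.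
Proof. by move=> x; apply: linear0. Qed.

Lemma tensor_mul0r : right_zero 0 tensor_mul.
Proof.
move=> x; have [s ->] := tensorW x; rewrite [LHS]tensor_lift_pi.
by rewrite big1 // => p _; apply: linear0.
Qed.

Lemma tensor_mul_suml s y : tensor_mul (\sum_(p <- s) tens p.1 p.2) y =
  \sum_(p <- s) tensor_mul (tens p.1 p.2) y.
Proof.
exact: (big_morph (tensor_mul^~ y) (fun a b => tensor_mulDl a b y)
  (tensor_mul0l y)).
Qed.

Lemma tensor_mul_sumr x s : tensor_mul x (\sum_(p <- s) tens p.1 p.2) =
  \sum_(p <- s) tensor_mul x (tens p.1 p.2).
Proof. exact: (big_morph _ (tensor_mulDr x) (tensor_mul0r x)). Qed.

Lemma tensor_mul1l : left_id tensor_one tensor_mul.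
Proof.
move=> x; have [s ->] := tensorW x; rewrite pi_tensorE tensor_mul_sumr.
by apply: eq_bigr => p _; rewrite tensor_mul_tens !mul1r.
Qed.

Lemma tensor_mul1r : right_id tensor_one tensor_mul.
Proof.
move=> x; have [s ->] := tensorW x; rewrite pi_tensorE tensor_mul_suml.
by apply: eq_bigr => p _; rewrite tensor_mul_tens !mulr1.
Qed.

Lemma tensor_mulA : associative tensor_mul.
Proof.
have mulDS x I (s : seq I) F :
    tensor_mul x (\sum_(i <- s) F i) = \sum_(i <- s) tensor_mul x (F i).
  exact: (big_morph _ (tensor_mulDr x) (tensor_mul0r x)).
have mulSD x I (s : seq I) F :
    tensor_mul (\sum_(i <- s) F i) x = \sum_(i <- s) tensor_mul (F i) x.
  exact: (big_morph (tensor_mul^~ x) (fun y z => tensor_mulDl y z x)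
    (tensor_mul0l x)).
move=> x y z; have [r ->] := tensorW z; have [s ->] := tensorW x.
have [t ->] := tensorW y; rewrite !pi_tensorE.
rewrite [LHS]mulSD [X in _ = tensor_mul X _]mulSD [RHS]mulSD.
apply: eq_bigr => i _.
rewrite [X in tensor_mul _ X = _]mulSD [LHS]mulDS.
rewrite [X in _ = tensor_mul X _]mulDS [RHS]mulSD.
apply: eq_bigr => j _.
rewrite [X in tensor_mul _ X = _]mulDS [LHS]mulDS [RHS]mulDS.
apply: eq_bigr => k _.
by rewrite !tensor_mul_tens !mulrA.
Qed.

HB.instance Definition _ := GRing.Zmodule_isPzRing.Build (tensor A B)
  tensor_mulA tensor_mul1l tensor_mul1r tensor_mulDl tensor_mulDr.

Lemma tensM (a a' : A) (b b' : B) :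
  (a ⊗ b) * (a' ⊗ b') = (a * a') ⊗ (b * b').
Proof. exact: tensor_mul_tens. Qed.

End TensorAlgebra.

Section ContractMap.
Variables (K : fieldType) (U V : lmodType K).

Definition contractl_fun (f : {scalar U}) (u : U) (v : V) : V := f u *: v.
Definition contractr_fun (f : {scalar V}) (u : U) (v : V) : U := f v *: u.

Lemma contractl_fun_bilinear f : bilinear_for *:%R *:%R (contractl_fun f).
Proof.
split=> [v c u u'|u c v v']; rewrite /= /contractl_fun.
  by rewrite linearP /= scalerDl scalerA.
by rewrite scalerDr !scalerA mulrC.
Qed.

Lemma contractr_fun_bilinear f : bilinear_for *:%R *:%R (contractr_fun f).
Proof.
split=> [v c u u'|u c v v']; rewrite /= /contractr_fun.
  by rewrite scalerDr !scalerA mulrC.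
by rewrite linearP /= scalerDl scalerA.
Qed.

HB.instance Definition _ f := bilinear_isBilinear.Build K U V V *:%R *:%R
  (contractl_fun f) (contractl_fun_bilinear f).
HB.instance Definition _ f := bilinear_isBilinear.Build K U V U *:%R *:%R
  (contractr_fun f) (contractr_fun_bilinear f).

Definition contractl (f : {scalar U}) : tensor U V -> V :=
  tensor_lift (contractl_fun f).
Definition contractr (f : {scalar V}) : tensor U V -> U :=
  tensor_lift (contractr_fun f).

HB.instance Definition _ f := GRing.Linear.on (contractl f).
HB.instance Definition _ f := GRing.Linear.on (contractr f).

Lemma contractl_tens f u v : contractl f (u ⊗ v) = f u *: v.
Proof. exact: tensor_lift_tens. Qed.

Lemma contractr_tens f u v : contractr f (u ⊗ v) = f v *: u.
Proof. exact: tensor_lift_tens. Qed.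

End ContractMap.

Section Multiplication.
Variables (K : fieldType) (A : algType K).

Definition mul_fun (a b : A) : A := a * b.

Lemma mul_fun_bilinear : bilinear_for *:%R *:%R mul_fun.
Proof.
split=> [b c a a'|a c b b']; rewrite /= /mul_fun.
  by rewrite mulrDl scalerAl.
by rewrite mulrDr scalerAr.
Qed.

HB.instance Definition _ := bilinear_isBilinear.Build K A A A *:%R *:%R
  mul_fun mul_fun_bilinear.

Definition tensor_mult : tensor A A -> A := tensor_lift mul_fun.

HB.instance Definition _ := GRing.Linear.on tensor_mult.

Lemma tensor_mult_tens a b : tensor_mult (a ⊗ b) = a * b.
Proof. exact: tensor_lift_tens. Qed.

End Multiplication.

HB.mixin Record Algebra_isHopf (K : fieldType) A of GRing.Algebra K A := {
  comul : {linear A -> tensor A A};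
  counit : {scalar A};
  antipode : {linear A -> A};
  comul_monoid_morphism : monoid_morphism comul;
  counit_monoid_morphism : monoid_morphism counit;
  comulA : forall x, tensor_assoc (tensor_map comul idfun (comul x)) =
                     tensor_map idfun comul (comul x);
  counitl : forall x, contractl counit (comul x) = x;
  counitr : forall x, contractr counit (comul x) = x;
  antipodel : forall x,
    tensor_mult (tensor_map antipode idfun (comul x)) = counit x *: 1;
  antipoder : forall x,
    tensor_mult (tensor_map idfun antipode (comul x)) = counit x *: 1
}.

#[short(type="hopfAlgType")]
HB.structure Definition HopfAlgebra (K : fieldType) :=
  {A of GRing.Algebra K A & Algebra_isHopf K A}.

Local Open Scope classical_set_scope.

(* Image of [M (x) N] in [U (x) V]. *)
Definition tensor_set (K : fieldType) (U V : lmodType K) (M : set U) (N : set V)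
    : set (tensor U V) :=
  [set x | exists2 s : seq (U * V),
     forall p, p \in s -> M p.1 /\ N p.2 & x = \sum_(p <- s) p.1 ⊗ p.2].

Section GroupLikeProjections.
Variables (K : fieldType) (A : hopfAlgType K).
Implicit Types (P L : A) (N : set A).

Definition right_grouplike_projection P :=
  [/\ P != 0, P * P = P, comul P * (1 ⊗ P) = P ⊗ P
    & (1 ⊗ P) * comul P = P ⊗ P].

Definition left_coideal_subalgebra N :=
  GRing.subalg_closed (mem N) /\ comul @` N `<=` tensor_set setT N.

Definition left_stabilizer P : set A :=
  [set x | (1 ⊗ P) * comul x = x ⊗ P].

Definition right_stabilizer P : set A :=
  [set x | comul x * (1 ⊗ P) = x ⊗ P].

Definition stabilizer P : set A := left_stabilizer P `&` right_stabilizer P.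

Definition left_integral N L := N L /\ forall x, N x -> x * L = counit x *: L.

Definition right_integral N L := N L /\ forall x, N x -> L * x = counit x *: L.

Definition two_sided_integral N L := left_integral N L /\ right_integral N L.

Definition counital L := counit L = 1.

Definition maximal_left_coideal_subalgebra (R : set A -> Prop) N :=
  [/\ left_coideal_subalgebra N, R N
    & forall M, left_coideal_subalgebra M -> R M -> N `<=` M -> M = N].

End GroupLikeProjections.

(* Main.v *)
From HB Require Import structures.
Require Import Defs.
From mathcomp Require Import all_boot all_algebra.
From mathcomp Require Import boolp classical_sets.

Import GRing.Theory.
Local Open Scope classical_set_scope.
Local Open Scope ring_scope.

(** Write [phi] for left or right multiplication by [P]. In Sweedler notation,
    [x] lies in the corresponding stabilizer exactly when
    [x_1 ⊗ phi x_2 = x ⊗ P].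

    If [N] is a left coideal subalgebra for which [P] is an integral, the
    factors [x_2] can be taken in [N], where [phi] is [counit] times [P]; hence
    [x_1 ⊗ phi x_2 = x_1 ⊗ counit x_2 *: P = x ⊗ P] ([sub_absorber]). So the
    stabilizer contains every such [N], and it is maximal as soon as it belongs
    to the family itself.

    That [P] is an integral for its stabilizer comes from applying
    [counit ⊗ id] to [x_1 ⊗ phi x_2 = x ⊗ P], which gives
    [phi x = counit x *: P] ([absorber_eval]); taking [x = P] yields
    [P = counit P *: P], hence [counit P = 1].

    The substantial point is that a stabilizer is a left coideal
    ([comul_joint_absorber]). It is the kernel of the linear map
    [T x = x_1 ⊗ phi x_2 - x ⊗ P], and coassociativity gives
    [(id ⊗ T) (comul x) = 0]. To conclude one needs the kernel of [id ⊗ T] to be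
    [A ⊗ ker T], which rests on the flatness of [A] over the field
    ([tensor_setT_joint_kernel]). The two-sided stabilizer is the common kernel
    of two such maps, so all of this is done for families of maps. *)

(** * Kernels in a tensor product over a field *)

(** The functional is the coordinate along [v] with respect to a subspace [M]
    that Zorn's lemma makes maximal among those avoiding [v]: maximality forces
    [M] and [v] to span the whole space. *)
Lemma exists_scalar_eq1 (K : fieldType) (V : lmodType K) (v : V) :
  v != 0 -> exists f : {scalar V}, f v = 1.
Proof.
move=> v0.
pose sub (M : set V) := forall c x y, M x -> M y -> M (c *: x + y).
have [M [[subM Mv] maxM]] : exists M, (sub M /\ ~ M v) /\
    forall B, M `<` B -> ~ (sub B /\ ~ B v).
  apply: (@Zorn_bigcup V [set M | sub M /\ ~ M v]) => F FP totF; split=> /=.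
    move=> c x y [X FX Xx] [Y FY Yy].
    have [XY|YX] := totF _ _ FX FY.
      by exists Y => //; apply: (proj1 (FP _ FY)) => //; apply: XY.
    by exists X => //; apply: (proj1 (FP _ FX)) => //; apply: YX.
  by move=> [X FX Xv]; apply: (proj2 (FP _ FX)).
(* The empty set is closed under [sub], so [M] is not yet known to contain [0]. *)
have M0 : M 0.
  apply: contrapT => nM0; apply: (maxM [set 0]).
    have Mempty x : ~ M x.
      by move=> Mx; apply: nM0; rewrite -(addNr x) -scaleN1r; apply: subM.
    by split=> [x /Mempty|/(_ 0 erefl)].
  split=> [c x y -> ->|/eqP]; first by rewrite scaler0 addr0.
  by rewrite (negPf v0).
have MZ (c : K) x : M x -> M (c *: x).
  by move=> Mx; rewrite -[_ *: _]addr0; apply: subM.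
have coord u : exists c, M (u - c *: v).
  have [Mu|nMu] := pselect (M u); first by exists 0; rewrite scale0r subr0.
  pose B : set V := [set w | exists c, M (w - c *: u)].
  have MB w : M w -> B w by move=> Mw; exists 0; rewrite scale0r subr0.
  have subB : sub B.
    move=> c x y [a Ma] [b Mb]; exists (c * a + b).
    rewrite scalerDl -scalerA opprD addrACA -scalerBr.
    exact: subM.
  have Bu : B u by exists 1; rewrite scale1r subrr.
  have [c Mc] : B v.
    apply: contrapT => nBv; apply: (maxM B) => //.
    by split=> // BM; apply: nMu; apply: BM.
  have c0 : c != 0.
    by apply/eqP => c0; apply: Mv; rewrite c0 scale0r subr0 in Mc.
  exists c^-1; rewrite -opprB -scaleN1r; apply: (MZ _ _ _).
  have -> : c^-1 *: v - u = c^-1 *: (v - c *: u).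
    by rewrite scalerBr scalerA mulVf // scale1r.
  exact: MZ.
have coord_uniq u c d : M (u - c *: v) -> M (u - d *: v) -> c = d.
  move=> Mc Md; have [/subr0_eq //|cd] := eqVneq (c - d) 0.
  case: Mv; rewrite -[v]scale1r -(mulVf cd) -scalerA; apply: (MZ _ _ _).
  have -> : (c - d) *: v = -1 *: (u - c *: v) + (u - d *: v).
    by rewrite scaleN1r opprB addrA subrK scalerBl.
  exact: subM.
have [f fP] := choice coord.
have f_lin : linear_for *%R f.
  move=> c x y; apply: (coord_uniq (c *: x + y)) => //.
  rewrite scalerDl -scalerA opprD addrACA -scalerBr.
  exact: subM.
pose F : {scalar V} := HB.pack f (GRing.isLinear.Build K V K *%R f f_lin).
exists F; apply: (coord_uniq v) => //.
by rewrite scale1r subrr.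
Qed.

(** Flatness in elementary form. If an entry [(a, b)] of a decomposition of [y]
    has [T i b != 0], a functional [g] with [g (T i b) = 1] turns
    [(id ⊗ T i) y = 0] into an expression of [a] through the other first
    factors; substituting it shortens the decomposition. The process stops when
    all second factors lie in the common kernel. *)
Lemma tensor_setT_joint_kernel (K : fieldType) (U V W : lmodType K) (I : Type)
    (T : I -> {linear V -> W}) (y : tensor U V) :
  (forall i, tensor_map idfun (T i) y = 0) ->
  tensor_set setT [set v | forall i, T i v = 0] y.
Proof.
have [s ->] := tensorW y; rewrite pi_tensorE {y}.
have [n] := ubnP (size s); elim: n s => // n IHn [|[a b] s] /=.
  by move=> _ _; exists nil.
rewrite big_cons /= ltnS => lt_s_n ker_y.
have [Tb0|] := pselect (forall i, T i b = 0).
  have [|t tP ->] := IHn s lt_s_n.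
    move=> i; have := ker_y i.
    by rewrite linearD /= tensor_map_tens Tb0 linear0r add0r.
  exists ((a, b) :: t); last by rewrite big_cons.
  by move=> p; rewrite in_cons => /predU1P[-> //|/tP].
move=> /existsNP[i /eqP/exists_scalar_eq1[g gTb]].
have a_eq : a = - \sum_(p <- s) g (T i p.2) *: p.1.
  have sliceE (t : seq (U * V)) :
      contractr g (tensor_map idfun (T i) (\sum_(p <- t) p.1 ⊗ p.2)) =
      \sum_(p <- t) g (T i p.2) *: p.1.
    rewrite (linear_sum (tensor_map idfun (T i))) (linear_sum (contractr g)).
    apply: eq_bigr => p _ /=.
    by rewrite tensor_map_tens contractr_tens.
  have := sliceE ((a, b) :: s); rewrite !big_cons /= ker_y linear0 gTb scale1r.
  by move=> /esym/eqP; rewrite addr_eq0 => /eqP.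
pose s' := [seq (p.1, p.2 - g (T i p.2) *: b) | p <- s].
have s'E : a ⊗ b + \sum_(p <- s) p.1 ⊗ p.2 = \sum_(p <- s') p.1 ⊗ p.2.
  rewrite a_eq linearNl linear_sumlz big_map addrC -sumrN -big_split /=.
  by apply: eq_bigr => p _; rewrite linearBr linearZl_LR linearZr_LR.
by rewrite s'E in ker_y *; apply: IHn => //; rewrite size_map.
Qed.

(** * Naturality of contraction and associativity *)

Section TensorMapNaturality.
Variables (K : fieldType).

Lemma contractl_map_r (U V V' : lmodType K) (f : {scalar U})
    (g : {linear V -> V'}) (y : tensor U V) :
  contractl f (tensor_map idfun g y) = g (contractl f y).
Proof.
apply: (@tensor_linear_ext _ _ _ _ (contractl f \o tensor_map idfun g)
  (g \o contractl f)) => u v /=.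
by rewrite tensor_map_tens !contractl_tens linearZ.
Qed.

Lemma tensor_map_rl (U U' V V' : lmodType K) (f : {linear U -> U'})
    (g : {linear V -> V'}) (y : tensor U V) :
  tensor_map idfun g (tensor_map f idfun y) =
  tensor_map f idfun (tensor_map idfun g y).
Proof.
apply: (@tensor_linear_ext _ _ _ _ (tensor_map idfun g \o tensor_map f idfun)
  (tensor_map f idfun \o tensor_map idfun g)) => u v /=.
by rewrite !tensor_map_tens.
Qed.

Lemma tensor_assoc_map_r (U V W W' : lmodType K) (g : {linear W -> W'})
    (z : tensor (tensor U V) W) :
  tensor_assoc (tensor_map idfun g z) =
  tensor_map idfun (tensor_map idfun g) (tensor_assoc z).
Proof.
apply: (@tensor_linear_ext _ _ _ _
  (@tensor_assoc _ U V W' \o tensor_map idfun g)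
  (tensor_map idfun (tensor_map idfun g) \o @tensor_assoc _ U V W)) => y w /=.
rewrite tensor_map_tens; apply: (@tensor_linear_ext _ _ _ _
  (@tensor_assoc _ U V W' \o applyr tens (g w))
  (tensor_map idfun (tensor_map idfun g) \o @tensor_assoc _ U V W
     \o applyr tens w)) => u v /=.
by rewrite !tensor_assoc_tens tensor_map_tens /= tensor_map_tens.
Qed.

End TensorMapNaturality.

(** * Elements absorbed by a linear map *)

(** Common form of the two one-sided stabilizers: they arise for [phi] the left
    and the right multiplication by [P]. *)
Definition absorber {K : fieldType} {A : hopfAlgType K}
    (phi : {linear A -> A}) (P : A) : set A :=
  [set x | tensor_map idfun phi (comul x) = x ⊗ P].

Section Absorber.
Variables (K : fieldType) (A : hopfAlgType K).
Implicit Types (phi : {linear A -> A}) (P x y : A) (N : set A).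

(** Apply [counit ⊗ id] to the defining equation. *)
Lemma absorber_eval phi P x : absorber phi P x -> phi x = counit x *: P.
Proof.
move=> /(congr1 (contractl counit)); rewrite contractl_tens => <-.
by rewrite contractl_map_r counitl.
Qed.

(** The left coideal property is what allows [phi] to be evaluated on the second
    factors of [comul x]. *)
Lemma sub_absorber phi P N : comul @` N `<=` tensor_set setT N ->
  (forall y, N y -> phi y = counit y *: P) -> N `<=` absorber phi P.
Proof.
move=> coN phiN x Nx; rewrite /absorber /= -{2}(counitr x).
have [|s sN ->] := coN (comul x); first by exists x.
rewrite (linear_sum (tensor_map idfun phi)) (linear_sum (contractr counit)).
rewrite linear_sumlz; apply: eq_big_seq => p /sN[_ Np] /=.
by rewrite tensor_map_tens contractr_tens phiN // linearZl_LR linearZr_LR.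
Qed.

Lemma absorber_linear phi P (c : K) x y :
  absorber phi P x -> absorber phi P y -> absorber phi P (c *: x + y).
Proof.
rewrite /absorber /= => xP yP.
by rewrite (linearP comul) (linearP (tensor_map idfun phi)) /= xP yP linearPl.
Qed.

(** Applying [id ⊗ T] to [comul x] and using coassociativity gives
    [(comul ⊗ id) (x_1 ⊗ phi x_2) - comul x ⊗ P], which vanishes because
    [x_1 ⊗ phi x_2 = x ⊗ P]. *)
Lemma comul_joint_absorber (I : Type) (phi : I -> {linear A -> A}) P :
  let N := [set x | forall i, absorber (phi i) P x] in
  comul @` N `<=` tensor_set setT N.
Proof.
move=> /= _ [x Nx <-].
pose T i : {linear A -> tensor A A} :=
  (tensor_map idfun (phi i) \o comul) \- applyr tens P.
suff : tensor_set setT [set v | forall i, T i v = 0] (comul x).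
  move=> [s sP ->]; exists s => // p /sP[_ Tp]; split=> // i.
  exact/subr0_eq/Tp.
apply: tensor_setT_joint_kernel => i.
have TE (y : tensor A A) : tensor_map idfun (T i) y =
    tensor_map idfun (tensor_map idfun (phi i)) (tensor_map idfun comul y)
    - tensor_assoc (y ⊗ P).
  apply: (@tensor_linear_ext _ _ _ _ (tensor_map idfun (T i))
    ((tensor_map idfun (tensor_map idfun (phi i)) \o tensor_map idfun comul)
     \- (@tensor_assoc K A A A \o applyr tens P))) => u v /=.
  by rewrite !tensor_map_tens tensor_assoc_tens linearBr.
rewrite TE -comulA -tensor_assoc_map_r tensor_map_rl (Nx i) tensor_map_tens.
by rewrite subrr.
Qed.

End Absorber.

(** * The stabilizers of an element *)

Section Stabilizers.
Variables (K : fieldType) (A : hopfAlgType K).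
Implicit Types (P x y : A) (N : set A).

Lemma left_stabilizerE P : left_stabilizer P = absorber (P \*o idfun) P.
Proof.
suff mulE (y : tensor A A) : (1 ⊗ P) * y = tensor_map idfun (P \*o idfun) y.
  rewrite /left_stabilizer /absorber.
  by apply/seteqP; split=> x /=; rewrite mulE.
have [s ->] := tensorW y; rewrite pi_tensorE mulr_sumr linear_sum.
by apply: eq_bigr => p _; rewrite tensM mul1r /= tensor_map_tens.
Qed.

Lemma right_stabilizerE P : right_stabilizer P = absorber (P \o* idfun) P.
Proof.
suff mulE (y : tensor A A) : y * (1 ⊗ P) = tensor_map idfun (P \o* idfun) y.
  rewrite /right_stabilizer /absorber.
  by apply/seteqP; split=> x /=; rewrite mulE.
have [s ->] := tensorW y; rewrite pi_tensorE mulr_suml linear_sum.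
by apply: eq_bigr => p _; rewrite tensM mulr1 /= tensor_map_tens.
Qed.

(** Products: [(1 ⊗ P) * comul x * comul y] becomes [(x ⊗ P) * comul y], and
    [x ⊗ P = (x ⊗ 1) * (1 ⊗ P)] lets [1 ⊗ P] act on [comul y] in turn. *)
Lemma subalg_left_stabilizer P : GRing.subalg_closed (mem (left_stabilizer P)).
Proof.
have [comul1 comulM] := @comul_monoid_morphism K A.
split=> [|c x y|x y]; rewrite !inE.
- by rewrite /left_stabilizer /= comul1 mulr1.
- by rewrite left_stabilizerE; apply: absorber_linear.
- rewrite /left_stabilizer /= => xP yP; rewrite comulM mulrA xP.
  by rewrite -[x]mulr1 -[X in _ ⊗ X]mul1r -tensM -mulrA yP tensM !mulr1 mul1r.
Qed.

Lemma subalg_right_stabilizer P :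
  GRing.subalg_closed (mem (right_stabilizer P)).
Proof.
have [comul1 comulM] := @comul_monoid_morphism K A.
split=> [|c x y|x y]; rewrite !inE.
- by rewrite /right_stabilizer /= comul1 mul1r.
- by rewrite right_stabilizerE; apply: absorber_linear.
- rewrite /right_stabilizer /= => xP yP; rewrite comulM -mulrA yP.
  by rewrite -[y]mul1r -[X in _ ⊗ X]mulr1 -tensM mulrA xP tensM !mul1r mulr1.
Qed.

Lemma left_coideal_left_stabilizer P :
  left_coideal_subalgebra (left_stabilizer P).
Proof.
split; first exact: subalg_left_stabilizer.
have -> : left_stabilizer P =
    [set x | forall _ : unit, absorber (P \*o idfun) P x].
  by rewrite left_stabilizerE; apply/seteqP; split=> [x xP []|x /(_ tt)].
exact: comul_joint_absorber.
Qed.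

Lemma left_coideal_right_stabilizer P :
  left_coideal_subalgebra (right_stabilizer P).
Proof.
split; first exact: subalg_right_stabilizer.
have -> : right_stabilizer P =
    [set x | forall _ : unit, absorber (P \o* idfun) P x].
  by rewrite right_stabilizerE; apply/seteqP; split=> [x xP []|x /(_ tt)].
exact: comul_joint_absorber.
Qed.

Lemma left_coideal_stabilizer P : left_coideal_subalgebra (stabilizer P).
Proof.
split; last first.
  pose phi (b : bool) : {linear A -> A} :=
    if b return {linear A -> A} then P \*o idfun else P \o* idfun.
  have -> : stabilizer P = [set x | forall b, absorber (phi b) P x].
    rewrite /stabilizer left_stabilizerE right_stabilizerE.
    apply/seteqP; split=> [x [xl xr] []|x xP] //.
    by split; [apply: (xP true)|apply: (xP false)].
  exact: comul_joint_absorber.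
have [l1 lP lM] := subalg_left_stabilizer P.
have [r1 rP rM] := subalg_right_stabilizer P.
split=> [|c x y|x y]; first by rewrite inE; split; apply: set_mem.
  rewrite !inE => -[xl xr] [yl yr]; split; apply: set_mem.
    by apply: lP; apply: mem_set.
  by apply: rP; apply: mem_set.
rewrite !inE => -[xl xr] [yl yr]; split; apply: set_mem.
  by apply: lM; apply: mem_set.
by apply: rM; apply: mem_set.
Qed.

(** By [absorber_eval] at [x = P], the idempotent [P = P * P] equals
    [counit P *: P]. *)
Lemma grouplike_counital P : right_grouplike_projection P -> counital P.
Proof.
move=> [P0 PP PdP _].
have Pr : absorber (P \o* idfun) P P by rewrite -right_stabilizerE.
have /= := absorber_eval _ _ _ _ _ Pr; rewrite PP -{1}[P]scale1r => /eqP.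
by rewrite -subr_eq0 -scalerBl scaler_eq0 (negPf P0) orbF subr_eq0 => /eqP/esym.
Qed.

Lemma right_integral_left_stabilizer P : right_grouplike_projection P ->
  right_integral (left_stabilizer P) P.
Proof.
move=> [_ _ _ PdP]; split=> // x.
by rewrite left_stabilizerE => /absorber_eval.
Qed.

Lemma left_integral_right_stabilizer P : right_grouplike_projection P ->
  left_integral (right_stabilizer P) P.
Proof.
move=> [_ _ PdP _]; split=> // x.
by rewrite right_stabilizerE => /absorber_eval.
Qed.

Lemma two_sided_integral_stabilizer P : right_grouplike_projection P ->
  two_sided_integral (stabilizer P) P.
Proof.
move=> gP; have [Pr rP] := left_integral_right_stabilizer P gP.
have [Pl lP] := right_integral_left_stabilizer P gP.
by split; split=> // x [xl xr]; [apply: rP|apply: lP].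
Qed.

Lemma sub_left_stabilizer P N : left_coideal_subalgebra N ->
  right_integral N P -> N `<=` left_stabilizer P.
Proof.
by move=> [_ coN] [_ NP]; rewrite left_stabilizerE; apply: sub_absorber.
Qed.

Lemma sub_right_stabilizer P N : left_coideal_subalgebra N ->
  left_integral N P -> N `<=` right_stabilizer P.
Proof.
by move=> [_ coN] [_ NP]; rewrite right_stabilizerE; apply: sub_absorber.
Qed.

Lemma sub_stabilizer P N : left_coideal_subalgebra N ->
  two_sided_integral N P -> N `<=` stabilizer P.
Proof.
move=> cN [lN rN] x Nx; split; first exact: sub_left_stabilizer rN _ Nx.
exact: sub_right_stabilizer lN _ Nx.
Qed.

Lemma maximal_left_coideal_greatest (R : set A -> Prop) N :
  left_coideal_subalgebra N -> R N ->
  (forall M, left_coideal_subalgebra M -> R M -> M `<=` N) ->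
  maximal_left_coideal_subalgebra R N.
Proof.
move=> cN RN maxN; split=> // M cM RM NM.
by apply/seteqP; split=> //; apply: maxN.
Qed.

End Stabilizers.

(** * Maximality *)

Theorem proposition3p11 (K : fieldType) (A : hopfAlgType K)
    (antipode_bij : bijective (@antipode K A))
    (P : A) (P_grouplike : right_grouplike_projection P) :
  [/\ (forall N : set A, left_coideal_subalgebra N ->
         two_sided_integral N P -> counital P -> N `<=` stabilizer P) /\
      maximal_left_coideal_subalgebra
        (fun N => two_sided_integral N P /\ counital P) (stabilizer P),
      (forall N : set A, left_coideal_subalgebra N ->
         right_integral N P -> counital P -> N `<=` left_stabilizer P) /\
      maximal_left_coideal_subalgebra
        (fun N => right_integral N P /\ counital P) (left_stabilizer P)
    & (forall N : set A, left_coideal_subalgebra N ->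
         left_integral N P -> counital P -> N `<=` right_stabilizer P) /\
      maximal_left_coideal_subalgebra
        (fun N => left_integral N P /\ counital P) (right_stabilizer P)].
Proof.
have P_counital := grouplike_counital _ _ _ P_grouplike.
split; split.
- by move=> N cN PN _; apply: sub_stabilizer.
- apply: maximal_left_coideal_greatest.
  + exact: left_coideal_stabilizer.
  + by split=> //; apply: two_sided_integral_stabilizer.
  + by move=> M cM [PM _]; apply: sub_stabilizer.
- by move=> N cN PN _; apply: sub_left_stabilizer.
- apply: maximal_left_coideal_greatest.
  + exact: left_coideal_left_stabilizer.
  + by split=> //; apply: right_integral_left_stabilizer.
  + by move=> M cM [PM _]; apply: sub_left_stabilizer.
- by move=> N cN PN _; apply: sub_right_stabilizer.
- apply: maximal_left_coideal_greatest.
  + exact: left_coideal_right_stabilizer.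
  + by split=> //; apply: left_integral_right_stabilizer.
  + by move=> M cM [PM _]; apply: sub_right_stabilizer.
Qed.
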